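(* Let $q\ge 0$ with $q\neq 1$, and let $u$ be a rate function. The stationary distribution corresponding to $u$ in the PALRMP with parameter $q$ is factorised if and only if there exists $\phi:\mathbb{N}_0\to\mathbb{R}_{>0}$ such that for all $n\in\mathbb{N}_0$, $$u(m,n)=\begin{cases}\phi(n), & m\ge 1,\\ 0, & m=0.\end{cases}$$ In this case, a one-point function corresponding to $u$ is given by $$f(x,n)=x^n\prod_{i=1}^{n}\phi(i-1).$$
   Context: $\mathbb{N}=\{1,2,\dots\}$, $\mathbb{N}_0=\mathbb{N}\cup\{0\}$, $[L]=\{1,\dots,L\}$. For $L,N\in\mathbb{N}$, $\Omega_{L,N}=\{\eta=(\eta_1,\dots,\eta_L)\in\mathbb{N}_0^L:\sum_\ell\eta_\ell=N\}$; $\eta_\ell$ is the number of particles at site $\ell$, and sites are arranged on a ring with indices modulo $L$ increasing clockwise. A rate function is $u:\mathbb{N}_0\times\mathbb{N}_0\to\mathbb{R}_{\ge0}$ with $u(m,n)>0$ if $m\ge1$ and $u(0,n)=0$. For sites $k,\ell$, $\eta^{k,\ell}$ is given by $\eta^{k,\ell}_a=\eta_a-\delta_{k,a}+\delta_{\ell,a}$. PALRMP (partially asymmetric long range misanthrope process) with $q\ge0$, rate function $u$ and positive rate parameters $x_1,\dots,x_L$: the continuous-time Markov chain on $\Omega_{L,N}$ in which, from $\eta$, for every ordered pair of distinct sites $k\ne\ell$ with $\eta_k\ge1$: if all sites strictly between $k$ and $\ell$ going right (clockwise, i.e. $k+1,\dots,\ell-1$ mod $L$) are empty, a particle moves right from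 $k$ to $\ell$ (giving $\eta^{k,\ell}$) at rate $x_\ell u(\eta_k,\eta_\ell)$; if all sites strictly between $k$ and $\ell$ going left (i.e. $k-1,\dots,\ell+1$ mod $L$) are empty, a particle moves left from $k$ to $\ell$ (giving $\eta^{k,\ell}$) at rate $q\,x_\ell u(\eta_k,\eta_\ell)$. If both are possible they count as two transitions and their rates add. The chain is irreducible, so it has a unique stationary distribution. The stationary distribution corresponding to $u$ in the PALRMP (with given $q$) is factorised if there is $f:\mathbb{R}_{>0}\times\mathbb{N}_0\to\mathbb{R}_{>0}$ such that for all $L,N\in\mathbb{N}$ and all positive rate parameters $x_1,\dots,x_L$, the stationary distribution on $\Omega_{L,N}$ is $\pi(\eta)=\frac1{Z_{L,N}}\prod_{\ell=1}^L f(x_\ell,\eta_\ell)$, with $Z_{L,N}$ the normalising constant. Any such $f$ is called a one-point function corresponding to $u$ (it is not unique). *)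

(* Defs.v *)
From mathcomp Require Import all_boot all_order all_algebra.
From mathcomp Require Import reals.

Set Implicit Arguments.
Unset Strict Implicit.
Unset Printing Implicit Defensive.

Import Order.TTheory GRing.Theory Num.Theory.
Local Open Scope ring_scope.

(* Omega_{L,N}, with sites numbered from 0. Each occupation number is at most
   the total N, so bounding it by N loses nothing and makes the type finite. *)
Definition config (L N : nat) :=
  {eta : {ffun 'I_L -> 'I_N.+1} | (\sum_l (eta l : nat) == N)%N}.

Definition occ (L N : nat) (eta : config L N) (l : 'I_L) : nat := val eta l.

(* Number of clockwise steps from k to l on the ring, in {0, ..., L-1}. *)
Definition cwdist (L : nat) (k l : 'I_L) : nat := ((l + L - k) %% L)%N.

Definition right_clear (L N : nat) (eta : config L N) (k l : 'I_L) : bool :=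
  [forall a : 'I_L, (0 < cwdist k a < cwdist k l)%N ==> (occ eta a == 0%N)].

Definition left_clear (L N : nat) (eta : config L N) (k l : 'I_L) : bool :=
  [forall a : 'I_L, (0 < cwdist a k < cwdist l k)%N ==> (occ eta a == 0%N)].

(* eta' = eta^{k,l}; only used when occ eta k > 0, so that the truncated
   subtraction is the integer one. *)
Definition is_move (L N : nat) (eta : config L N) (k l : 'I_L)
    (eta' : config L N) : bool :=
  [forall a : 'I_L, occ eta' a == (occ eta a - (k == a) + (l == a))%N].

Definition rate_function (R : realType) (u : nat -> nat -> R) : Prop :=
  [/\ forall m n : nat, 0 <= u m n,
      forall m n : nat, (1 <= m)%N -> 0 < u m n
    & forall n : nat, u 0%N n = 0].

Definition palrmp_rate (R : realType) (q : R) (u : nat -> nat -> R)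
    (L N : nat) (x : 'I_L -> R) (eta eta' : config L N) : R :=
  \sum_(k < L) \sum_(l < L | [&& k != l, (1 <= occ eta k)%N
                               & is_move eta k l eta'])
    ((if right_clear eta k l then x l * u (occ eta k) (occ eta l) else 0) +
     (if left_clear eta k l then q * x l * u (occ eta k) (occ eta l) else 0)).

(* Stationary distribution of the continuous-time chain on S with jump rates r.
   The balance equation is pi Q = 0 for the generator Q of the chain (the
   diagonal terms r s s cancel). *)
Definition stationary_distribution (R : realType) (S : finType)
    (r : S -> S -> R) (pi : S -> R) : Prop :=
  [/\ forall s : S, 0 <= pi s,
      \sum_(s : S) pi s = 1
    & forall s : S, \sum_(t : S) pi t * r t s = pi s * \sum_(t : S) r s t].

Definition weight (R : realType) (f : R -> nat -> R) (L N : nat)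
    (x : 'I_L -> R) (eta : config L N) : R :=
  \prod_(l < L) f (x l) (occ eta l).

Definition partition_function (R : realType) (f : R -> nat -> R) (L N : nat)
    (x : 'I_L -> R) : R :=
  \sum_(eta : config L N) weight f x eta.

(* f is only meaningful on positive first arguments. The chain is irreducible,
   so being a stationary distribution means being the stationary one. *)
Definition one_point_function (R : realType) (q : R) (u : nat -> nat -> R)
    (f : R -> nat -> R) : Prop :=
  (forall (x : R) (n : nat), 0 < x -> 0 < f x n) /\
  (forall (L N : nat) (x : 'I_L -> R),
     (1 <= L)%N -> (1 <= N)%N -> (forall l : 'I_L, 0 < x l) ->
     stationary_distribution (@palrmp_rate R q u L N x)
       (fun eta : config L N =>
          (partition_function f N x)^-1 * weight f x eta)).

Definition factorised (R : realType) (q : R) (u : nat -> nat -> R) : Prop :=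
  exists f : R -> nat -> R, one_point_function q u f.

Definition target_only (R : realType) (u : nat -> nat -> R)
    (phi : nat -> R) : Prop :=
  (forall n : nat, 0 < phi n) /\
  (forall m n : nat, u m n = if (1 <= m)%N then phi n else 0).

(* Main.v *)
Require Import Defs.
From mathcomp Require Import all_boot all_order all_algebra.
From mathcomp Require Import reals.
From mathcomp Require Import zify ring lra.

Set Implicit Arguments.
Unset Strict Implicit.
Unset Printing Implicit Defensive.

Import Order.TTheory GRing.Theory Num.Theory.
Local Open Scope ring_scope.

(** Write w for the unnormalised product weight of a configuration, and for
    sites k and l let R(k,l) and L(k,l) be 1 or 0 according to whether the way
    from k to l is clear clockwise, respectively counterclockwise.

    The key is the exchange relation
      f(x,m) f(y,n+1) x u(n+1,m) = f(x,m+1) f(y,n) y u(m+1,n),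
    which says that, direction of travel aside, a jump between two sites and
    its reverse carry the same flow under w.  A particle that travels back
    from l to k uses the same arc as on the way from k to l, in the opposite
    direction.  Hence, under the exchange relation, the jump that undoes
    k -> l contributes w(s) x_l u(s_k,s_l) (L(k,l) + q R(k,l)) to the inflow
    into s, whereas k -> l contributes w(s) x_l u(s_k,s_l) (R(k,l) + q L(k,l))
    to the outflow.  So (inflow_sub_outflow)
      inflow - outflow = (q - 1) w(s) sum_l x_l sum_k u(s_k,s_l) (R(k,l) - L(k,l)),
    where k runs over the occupied sites other than l.

    If u(m,n) = phi(n) for positive m, then f(x,n) = x^n phi(0)...phi(n-1)
    satisfies the exchange relation, and the inner sum is phi(s_l) times the
    number of occupied k with a clear way clockwise to l, minus the number of
    those with a clear way counterclockwise.  Both numbers count the nearest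
    occupied site on one side of l: they are 1 if some other site is occupied
    and 0 otherwise, so the difference vanishes.

    Conversely, let f be any one-point function.  On two sites both ways are
    always clear, and the chain is a birth-and-death chain with all rates
    multiplied by 1 + q > 0; balance on a segment forces detailed balance, and
    that is the exchange relation for f (one_point_exchange).  The formula above
    is then available on every ring, and since q differs from 1 the linear form
    in x on its right vanishes at all positive x, so each coefficient does.  On
    three sites holding m+1, n and 1 particles, the coefficient of the middle
    site is u(m+1,n) - u(1,n). *)

(** * Distances and clear arcs on the ring *)

Lemma cwdistE (L : nat) (k l : 'I_L) :
  cwdist k l = if (k <= l)%N then (l - k)%N else (l + L - k)%N.
Proof.
rewrite /cwdist; have := ltn_ord k; have := ltn_ord l => hl hk.
case: leqP => hkl; last by rewrite modn_small //; lia.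
by rewrite (_ : (l + L - k = (l - k) + L)%N) ?modnDr ?modn_small //; lia.
Qed.

Lemma cwdist_gt0 (L : nat) (k l : 'I_L) : (0 < cwdist k l)%N = (k != l).
Proof.
rewrite cwdistE -val_eqE /=; have := ltn_ord k; have := ltn_ord l.
by case: (leqP k l); lia.
Qed.

(** Both sides say that [a] lies strictly inside the clockwise arc from [k] to
    [l], measured from its start or from its end. *)
Lemma cwdist_arc (L : nat) (k a l : 'I_L) :
  (0 < cwdist k a < cwdist k l)%N = (0 < cwdist a l < cwdist k l)%N.
Proof.
rewrite !cwdistE; have := ltn_ord k; have := ltn_ord a; have := ltn_ord l.
by case: (leqP k a); case: (leqP k l); case: (leqP a l); lia.
Qed.

Lemma cwdist_injr (L : nat) (k : 'I_L) : injective (cwdist k).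
Proof.
move=> a b; rewrite !cwdistE => h; apply: val_inj => /=; move: h.
have := ltn_ord k; have := ltn_ord a; have := ltn_ord b.
by case: (leqP k a); case: (leqP k b); lia.
Qed.

Lemma cwdist_injl (L : nat) (l : 'I_L) : injective (fun k : 'I_L => cwdist k l).
Proof.
move=> a b; rewrite !cwdistE => h; apply: val_inj => /=; move: h.
have := ltn_ord l; have := ltn_ord a; have := ltn_ord b.
by case: (leqP a l); case: (leqP b l); lia.
Qed.

(** Measuring from the target turns clearness into minimality: the occupied
    sites with a clear way to [l] are those nearest to [l] on one side. *)
Lemma right_clearE (L N : nat) (s : config L N) (k l : 'I_L) :
  right_clear s k l =
  [forall a, (a != l) && (0 < occ s a)%N ==> (cwdist k l <= cwdist a l)%N].
Proof.
apply: eq_forallb => a; rewrite cwdist_arc cwdist_gt0 lt0n.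
rewrite [(_ <= cwdist a l)%N]leqNgt.
by case: (a != l); case: (cwdist a l < _)%N; case: eqP.
Qed.

Lemma left_clearE (L N : nat) (s : config L N) (k l : 'I_L) :
  left_clear s k l =
  [forall a, (a != l) && (0 < occ s a)%N ==> (cwdist l k <= cwdist l a)%N].
Proof.
apply: eq_forallb => a; rewrite -cwdist_arc cwdist_gt0 lt0n eq_sym.
rewrite [(_ <= cwdist l a)%N]leqNgt.
by case: (a != l); case: (cwdist l a < _)%N; case: eqP.
Qed.

(** Injectivity excludes ties, so a nonempty finite set has exactly one
    minimiser.  Applied to the distance to a fixed site, in either direction, it
    counts the sites from which that site can be reached; the count depends
    only on [P], which is why both directions agree. *)
Lemma sum_minimisers (R : pzSemiRingType) (I : finType) (P : pred I)
    (D : I -> nat) : injective D ->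
  \sum_(k | P k) [forall a, P a ==> (D k <= D a)%N]%:R
    = [exists k, P k]%:R :> R.
Proof.
move=> Dinj; case: existsP => [[k0 Pk0]|noP]; last first.
  by rewrite big_pred0 // => k; apply: contra_notF noP; exists k.
case: (arg_minnP D Pk0) => k Pk minD; rewrite (bigD1 k) //= big1 ?addr0.
  by case: forallP => // -[] a; apply/implyP/minD.
move=> i /andP[Pi ik]; case: forallP => // /(_ k) /implyP /(_ Pk) ik_le.
have /Dinj eik : D i = D k by apply/eqP; rewrite eqn_leq ik_le minD.
by rewrite eik eqxx in ik.
Qed.

(** * Configurations and single jumps *)

Lemma config_exists (L N : nat) (g : 'I_L -> nat) :
  (\sum_l g l = N)%N -> exists s : config L N, forall a, occ s a = g a.
Proof.
move=> gN; have g_le a : (g a <= N)%N by rewrite -gN (bigD1 a) //= leq_addr.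
pose h : {ffun 'I_L -> 'I_N.+1} := [ffun a => inord (g a)].
have hE a : h a = g a :> nat by rewrite ffunE inordK // ltnS.
have hP : (\sum_l (h l : nat) == N)%N by rewrite (eq_bigr g) ?gN.
by exists (Sub h hP) => a; rewrite /occ SubK.
Qed.

Lemma occ_inj (L N : nat) (s t : config L N) : occ s =1 occ t -> s = t.
Proof. by move=> st; apply/val_inj/ffunP => a; apply/val_inj/st. Qed.

Section Moves.
Variables (L N : nat).
Implicit Types (s t : config L N) (k l : 'I_L).

Lemma is_moveP s k l t :
  reflect (forall a, occ t a = (occ s a - (k == a) + (l == a))%N)
          (is_move s k l t).
Proof. by apply: (iffP forallP) => h a; apply/eqP/h. Qed.

(** Occupancy of the source has to be part of the statement because the
    subtraction in [is_move] is truncated. *)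
Lemma is_move_rev s t k l : k != l ->
  (0 < occ s k)%N && is_move s k l t = (0 < occ t l)%N && is_move t l k s.
Proof.
suff imp s' t' k' l' : k' != l' -> (0 < occ s' k')%N && is_move s' k' l' t' ->
    (0 < occ t' l')%N && is_move t' l' k' s'.
  by move=> kl; apply/idP/idP; apply: imp => //; rewrite eq_sym.
move=> kl /andP[sk /is_moveP tE]; apply/andP; split.
  by rewrite tE eqxx addn1.
apply/is_moveP => a; rewrite tE; case: (eqVneq k' a) => [<-|_] /=.
  by rewrite eq_sym (negbTE kl); lia.
by case: (l' == a); lia.
Qed.

Lemma is_move_source s k l t : k != l -> is_move s k l t ->
  occ t k = (occ s k).-1.
Proof. by move=> kl /is_moveP->; rewrite eqxx eq_sym (negbTE kl); lia. Qed.

Lemma is_move_target s k l t : k != l -> is_move s k l t ->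
  occ t l = (occ s l).+1.
Proof. by move=> kl /is_moveP->; rewrite eqxx (negbTE kl); lia. Qed.

Lemma is_move_other s k l t a : a != k -> a != l -> is_move s k l t ->
  occ t a = occ s a.
Proof.
by move=> ak al /is_moveP->; rewrite ![_ == a]eq_sym (negbTE ak) (negbTE al); lia.
Qed.

(** A jump has exactly one outcome.  Phrasing this as the evaluation of a sum
    spares the choice of a name for that outcome. *)
Lemma sum_is_move (R : nmodType) s k l (F : config L N -> R) (c : R) :
  k != l -> (0 < occ s k)%N -> (forall t, is_move s k l t -> F t = c) ->
  \sum_(t | is_move s k l t) F t = c.
Proof.
move=> kl sk Fc.
have [|t0 t0E] := @config_exists L N (fun a => occ s a - (k == a) + (l == a))%N.
  have sN : (\sum_a occ s a = N)%N by apply/eqP/(valP s).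
  have lk : l != k by rewrite eq_sym.
  have D1 (g : 'I_L -> nat) : (\sum_a g a =
      g k + (g l + \sum_(a | (a != k) && (a != l)) g a))%N.
    by rewrite (bigD1 k) //= (bigD1 l).
  rewrite -[RHS]sN !D1 !eqxx (negbTE kl) (negbTE lk).
  rewrite [X in (_ + (_ + X) = _)%N](eq_bigr (occ s)); first by rewrite /=; lia.
  move=> a /andP[ak al].
  by rewrite ![_ == a]eq_sym (negbTE ak) (negbTE al); lia.
have t0P : is_move s k l t0 by apply/is_moveP.
rewrite (big_pred1 t0) ?Fc // => t; apply/idP/eqP => [/is_moveP tE|-> //].
by apply: occ_inj => a; rewrite tE t0E.
Qed.

(** The way back uses the same arc in the opposite direction, and the jump
    changes only the two endpoints of that arc. *)
Lemma left_clear_rev s k l t : is_move s k l t ->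
  left_clear t l k = right_clear s k l.
Proof.
move=> st; apply: eq_forallb => a; rewrite -cwdist_arc.
have [/andP[ka al] | //] := boolP (0 < _ < _)%N.
have ka' : a != k by rewrite eq_sym -cwdist_gt0.
have al' : a != l by apply: contraTneq al => ->; rewrite ltnn.
by rewrite (is_move_other ka' al' st).
Qed.

Lemma right_clear_rev s k l t : is_move s k l t ->
  right_clear t l k = left_clear s k l.
Proof.
move=> st; apply: eq_forallb => a; rewrite cwdist_arc.
have [/andP[ka al] | //] := boolP (0 < _ < _)%N.
have ka' : a != k by rewrite -cwdist_gt0.
have al' : a != l by apply: contraTneq al => ->; rewrite ltnn.
by rewrite (is_move_other ka' al' st).
Qed.

End Moves.

(** * Inflow and outflow of a product weight *)

Section Balance.
Variables (R : realType) (q : R) (u : nat -> nat -> R).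

Definition move_rate (L N : nat) (x : 'I_L -> R) (s : config L N) k l : R :=
  x l * u (occ s k) (occ s l) *
    ((right_clear s k l)%:R + q * (left_clear s k l)%:R).

Lemma palrmp_rateE (L N : nat) (x : 'I_L -> R) (s t : config L N) :
  palrmp_rate q u x s t =
  \sum_k \sum_(l | [&& k != l, (0 < occ s k)%N & is_move s k l t])
     move_rate x s k l.
Proof.
apply: eq_bigr => k _; apply: eq_bigr => l _; rewrite /move_rate.
by case: right_clear; case: left_clear => /=; ring.
Qed.

Lemma outflowE (L N : nat) (x : 'I_L -> R) (s : config L N) :
  \sum_t palrmp_rate q u x s t =
  \sum_l \sum_(k | (k != l) && (0 < occ s k)%N) move_rate x s k l.
Proof.
under eq_bigr do rewrite palrmp_rateE; rewrite exchange_big /=.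
rewrite [RHS](exchange_big_dep predT) //=; apply: eq_bigr => k _.
under eq_bigr do rewrite big_mkcond; rewrite exchange_big [RHS]big_mkcond /=.
apply: eq_bigr => l _; rewrite -big_mkcond /=.
case: ifP => [/andP[kl sk]|]; last first.
  move=> h; rewrite big_pred0 // => t; apply: contraFF h.
  by case/and3P=> -> ->.
under eq_bigl do rewrite kl sk /=.
exact: sum_is_move.
Qed.

(** The jumps that end in [s] are indexed by the jumps out of [s] that they
    undo, so that inflow and outflow become sums over the same pairs. *)
Lemma inflowE (L N : nat) (x : 'I_L -> R) (w : config L N -> R)
    (s : config L N) :
  \sum_t w t * palrmp_rate q u x t s =
  \sum_l \sum_(k | (k != l) && (0 < occ s k)%N)
     \sum_(t | is_move s k l t) w t * move_rate x t l k.
Proof.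
under eq_bigr => t _ do (rewrite palrmp_rateE mulr_sumr;
  under eq_bigr => l _ do rewrite mulr_sumr big_mkcond).
rewrite exchange_big /=; apply: eq_bigr => l _.
rewrite exchange_big [RHS]big_mkcond; apply: eq_bigr => k _ /=.
rewrite -big_mkcond /=; have [kl|] := boolP (k != l); last first.
  by rewrite negbK eq_sym => /eqP->; rewrite big_pred0 // => t; rewrite eqxx.
rewrite (eq_bigl (fun t => (0 < occ s k)%N && is_move s k l t)).
  by case: (0 < occ s k)%N; last exact: big_pred0.
by move=> t; rewrite is_move_rev // eq_sym kl.
Qed.

(** Detailed balance for the jumps between two sites with rate parameters [x]
    and [y], regardless of direction and of the rest of the ring. *)
Definition exchange_relation (f : R -> nat -> R) : Prop :=
  forall (x y : R) (m n : nat), 0 < x -> 0 < y ->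
    f x m * f y n.+1 * (x * u n.+1 m) = f x m.+1 * f y n * (y * u m.+1 n).

(** A jump changes only two factors of the weight, so the exchange relation
    for the pair of sites passes to the whole ring. *)
Lemma weight_exchange (f : R -> nat -> R) (L N : nat) (x : 'I_L -> R)
    (s t : config L N) (k l : 'I_L) :
  exchange_relation f -> (forall a, 0 < x a) ->
  k != l -> (0 < occ s k)%N -> is_move s k l t ->
  weight f x t * (x k * u (occ t l) (occ t k)) =
  weight f x s * (x l * u (occ s k) (occ s l)).
Proof.
move=> ex x0 kl sk st.
have wE (r : config L N) : weight f x r = f (x k) (occ r k) *
    (f (x l) (occ r l) *
     \prod_(a | (a != k) && (a != l)) f (x a) (occ r a)).
  by rewrite /weight (bigD1 k) //= (bigD1 l) 1?eq_sym.
rewrite !wE (is_move_source kl st) (is_move_target kl st).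
rewrite (eq_bigr (fun a => f (x a) (occ s a))); last first.
  by move=> a /andP[ak al]; rewrite (is_move_other ak al st).
case: (occ s k) sk => // m _ /=.
have := ex _ _ m (occ s l) (x0 k) (x0 l).
set P := \prod_(_ | _) _ => e.
transitivity (P * (f (x k) m * f (x l) (occ s l).+1 *
  (x k * u (occ s l).+1 m))); first by ring.
by rewrite e; ring.
Qed.

(** Pairing each jump with its reverse leaves only the mismatch of directions:
    the forward factor R + q L against the backward factor L + q R, whose
    difference is a multiple of q - 1. *)
Lemma inflow_sub_outflow (f : R -> nat -> R) (L N : nat) (x : 'I_L -> R)
    (s : config L N) :
  exchange_relation f -> (forall a, 0 < x a) ->
  \sum_t weight f x t * palrmp_rate q u x t s -
    weight f x s * \sum_t palrmp_rate q u x s t =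
  (q - 1) * weight f x s *
    \sum_l x l * \sum_(k | (k != l) && (0 < occ s k)%N)
      u (occ s k) (occ s l) *
        ((right_clear s k l)%:R - (left_clear s k l)%:R).
Proof.
move=> ex x0; rewrite inflowE outflowE !mulr_sumr -sumrB.
apply: eq_bigr => l _; rewrite !mulr_sumr -sumrB.
apply: eq_bigr => k /andP[kl sk].
rewrite (sum_is_move (c := weight f x s * (x l * u (occ s k) (occ s l)) *
  ((left_clear s k l)%:R + q * (right_clear s k l)%:R))) //.
  by rewrite /move_rate; ring.
move=> t st; rewrite /move_rate mulrA (weight_exchange ex x0 kl sk st).
by rewrite (right_clear_rev st) (left_clear_rev st).
Qed.

Lemma weight_gt0 (f : R -> nat -> R) (L N : nat) (x : 'I_L -> R)
    (s : config L N) :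
  (forall y n, 0 < y -> 0 < f y n) -> (forall a, 0 < x a) ->
  0 < weight f x s.
Proof. by move=> f0 x0; apply: prodr_gt0 => a _; apply: f0. Qed.

Lemma partition_function_gt0 (f : R -> nat -> R) (L N : nat) (x : 'I_L -> R) :
  (0 < L)%N -> (forall y n, 0 < y -> 0 < f y n) -> (forall a, 0 < x a) ->
  0 < partition_function f N x.
Proof.
move=> L0 f0 x0; have l0 : 'I_L := Ordinal L0.
have [|s _] := @config_exists L N (fun a => if a == l0 then N else 0)%N.
  by rewrite -big_mkcond big_pred1_eq.
rewrite /partition_function (bigD1 s) //= ltr_wpDr ?weight_gt0 //.
by apply: sumr_ge0 => t _; apply/ltW/weight_gt0.
Qed.

(** The balance equations are homogeneous in the measure, so the positive
    normalising constant cancels. *)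
Lemma stationary_weight (f : R -> nat -> R) (L N : nat) (x : 'I_L -> R) :
  (0 < L)%N -> (forall y n, 0 < y -> 0 < f y n) -> (forall a, 0 < x a) ->
  stationary_distribution (@palrmp_rate R q u L N x)
    (fun s => (partition_function f N x)^-1 * weight f x s) <->
  forall s : config L N, \sum_t weight f x t * palrmp_rate q u x t s =
    weight f x s * \sum_t palrmp_rate q u x s t.
Proof.
move=> L0 f0 x0; have Z0 := partition_function_gt0 N L0 f0 x0.
have Zu : partition_function f N x != 0 by rewrite gt_eqF.
split=> [[_ _ st] s|st].
  apply: (mulfI (invr_neq0 Zu)); rewrite mulrA -st mulr_sumr.
  by apply: eq_bigr => t _; rewrite mulrA.
split=> [s||s].
- by rewrite mulr_ge0 ?invr_ge0 ?(ltW Z0) // ltW // weight_gt0.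
- by rewrite -mulr_sumr mulVf.
- rewrite -mulrA -st mulr_sumr.
  by apply: eq_bigr => t _; rewrite mulrA.
Qed.

(** * Sufficiency: rates that depend on the target only *)

Lemma target_only_one_point (phi : nat -> R) : target_only u phi ->
  one_point_function q u
    (fun (x : R) (n : nat) => x ^+ n * \prod_(1 <= i < n.+1) phi (i - 1)%N).
Proof.
case=> phi0 uE; set f := (fun _ _ => _).
have f0 y n : 0 < y -> 0 < f y n.
  by move=> y0; rewrite mulr_gt0 ?exprn_gt0 ?prodr_gt0.
split=> // L N x L1 _ x0; apply/stationary_weight => // s.
have fS y n : f y n.+1 = f y n * (y * phi n).
  by rewrite /f exprSr big_nat_recr //= subn1 /=; ring.
apply/eqP; rewrite -subr_eq0 inflow_sub_outflow //; last first.
  by move=> y z m n _ _; rewrite !fS !uE /=; ring.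
rewrite big1 ?mulr0 // => l _.
have -> : \sum_(k | (k != l) && (0 < occ s k)%N)
      u (occ s k) (occ s l) *
        ((right_clear s k l)%:R - (left_clear s k l)%:R) =
    phi (occ s l) * (
      \sum_(k | (k != l) && (0 < occ s k)%N) (right_clear s k l)%:R -
      \sum_(k | (k != l) && (0 < occ s k)%N) (left_clear s k l)%:R).
  rewrite -sumrB mulr_sumr; apply: eq_bigr => k /andP[_ sk].
  by rewrite uE sk.
under eq_bigr do rewrite right_clearE.
under [X in _ - X]eq_bigr do rewrite left_clearE.
rewrite (sum_minimisers _ _ (@cwdist_injl L l)).
by rewrite (sum_minimisers _ _ (@cwdist_injr L l)) subrr !mulr0.
Qed.

(** * Necessity: two sites, then three sites *)

Lemma clear2 N (s : config 2 N) (k l : 'I_2) :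
  right_clear s k l && left_clear s k l.
Proof.
apply/andP; split; apply/forallP => a; apply/implyP;
rewrite !cwdistE; have := ltn_ord k; have := ltn_ord a; have := ltn_ord l;
by case: (leqP k a); case: (leqP k l); case: (leqP a l); case: (leqP l k);
  case: (leqP a k); lia.
Qed.

(** The balance equation at occupations [a] and [b].  Each of the two
    neighbouring configurations is reached in both directions, which gives a
    common factor 1 + q that is cancelled here. *)
Lemma two_site_balance (f : R -> nat -> R) (x y : R) (a b : nat) :
  0 <= q -> rate_function u ->
  one_point_function q u f -> 0 < x -> 0 < y -> (0 < a + b)%N ->
  (if (0 < a)%N then f x a.-1 * f y b.+1 * (x * u b.+1 a.-1) else 0) +
  (if (0 < b)%N then f x a.+1 * f y b.-1 * (y * u a.+1 b.-1) else 0) =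
  f x a * f y b * (y * u a b + x * u b a).
Proof.
move=> q0 [_ _ u0] [f0 st] x0 y0 ab.
(* Rate parameter [x] on the first site and [y] on the second. *)
pose z (i : 'I_2) := if i == ord0 then x else y.
have z0 i : 0 < z i by rewrite /z; case: ifP.
have {}st := (stationary_weight _ (isT : 0 < 2)%N f0 z0).1 (st 2 _ z isT ab z0).
have [|s sE] := @config_exists 2 (a + b) (fun i => if i == ord0 then a else b).
  by rewrite !big_ord_recl big_ord0 /= addn0.
have := st s; rewrite inflowE outflowE.
have q1 : 1 + q != 0 by rewrite gt_eqF // ltr_wpDr.
have zE : (z ord0 = x) * (z (lift ord0 ord0) = y) by [].
have s01 : (occ s ord0 = a) * (occ s (lift ord0 ord0) = b) by rewrite !sE.
have wE t : weight f z t = f x (occ t ord0) * f y (occ t (lift ord0 ord0)).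
  by rewrite /weight !big_ord_recl big_ord0 mulr1.
have rE t k l : move_rate z t k l = z l * u (occ t k) (occ t l) * (1 + q).
  by rewrite /move_rate; have /andP[-> ->] := clear2 t k l; rewrite mulr1.
rewrite !big_ord_recl !big_ord0 !(big_mkcond (fun k => (k != _) && _)) /=.
rewrite !big_ord_recl !big_ord0 /= !s01 !rE !wE !addr0 !add0r !s01 !zE => e.
have e1 : (0 < b)%N -> \sum_(t | is_move s (lift ord0 ord0) ord0 t)
     weight f z t * move_rate z t ord0 (lift ord0 ord0) =
     f x a.+1 * f y b.-1 * (y * u a.+1 b.-1 * (1 + q)).
  move=> b0; apply: sum_is_move; rewrite ?s01 // => t st'.
  by rewrite wE rE (is_move_target _ st') // (is_move_source _ st') // !s01.
have e2 : (0 < a)%N -> \sum_(t | is_move s ord0 (lift ord0 ord0) t)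
     weight f z t * move_rate z t (lift ord0 ord0) ord0 =
     f x a.-1 * f y b.+1 * (x * u b.+1 a.-1 * (1 + q)).
  move=> a0; apply: sum_is_move; rewrite ?s01 // => t st'.
  by rewrite wE rE (is_move_target _ st') // (is_move_source _ st') // !s01.
have ua : a = 0%N -> u a b = 0 by move->.
have ub : b = 0%N -> u b a = 0 by move->.
apply: (mulIf q1); move: e.
have [b0|b0] := posnP b; have [a0|a0] := posnP a; rewrite ?e1 ?e2 //.
- by move: ab; rewrite a0 b0.
(* At an end of the segment a neighbour is missing, and the rate of the jump
   towards it is 0 because its source is empty. *)
- by rewrite ub // => e; lra.
- by rewrite ua // => e; lra.
- by move=> e; lra.
Qed.

(** The two-site chain lives on a segment, so the net flow through each of its
    edges vanishes: there is none through the left end, and balance at a vertex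
    carries this from one edge to the next. *)
Lemma one_point_exchange (f : R -> nat -> R) :
  0 <= q -> rate_function u -> one_point_function q u f -> exchange_relation f.
Proof.
move=> q0 hu fu x y m n x0 y0; have [_ _ u0] := hu.
have bal a b := @two_site_balance f x y a b q0 hu fu x0 y0.
elim: m n => [|m IH] n.
  by have /= := bal 0%N n.+1 isT; rewrite u0 mulr0 !add0r.
have /= := bal m.+1 n.+1 isT; rewrite IH mulrDr => /addrI->.
by [].
Qed.

(** Compare the values at the all-ones vector and at the same vector with one
    coordinate raised to 2. *)
Lemma positive_linear_form_eq0 (I : finType) (S : I -> R) :
  (forall x : I -> R, (forall i, 0 < x i) -> \sum_i x i * S i = 0) ->
  forall i, S i = 0.
Proof.
move=> S0 i; have S1 := S0 (fun=> 1) (fun=> ltr01).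
have := S0 (fun j => 1 + (j == i)%:R) (fun j => ltr_wpDr (ler0n _ _) ltr01).
under eq_bigr do rewrite mulrDl; rewrite big_split /= S1 add0r.
rewrite (bigD1 i) //= eqxx mul1r big1 ?addr0 // => j /negbTE->.
by rewrite mul0r.
Qed.

(** Use three sites holding [m.+1], [n] and 1 particles in clockwise order.
    As both neighbours of the middle site are occupied, it can be reached
    clockwise only from the first and counterclockwise only from the last. *)
Lemma one_point_target_only (f : R -> nat -> R) :
  0 <= q -> q != 1 -> rate_function u -> one_point_function q u f ->
  target_only u (u 1%N).
Proof.
move=> q0 q1 hu fu; have ex := one_point_exchange q0 hu fu.
have [_ u_gt0 u0] := hu; have [f0 st] := fu.
split=> [n|m n]; first exact: u_gt0.
case: m => [|m] //=.
pose i0 : 'I_3 := ord0; pose i1 : 'I_3 := lift ord0 ord0.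
pose i2 : 'I_3 := lift ord0 (lift ord0 ord0).
have [|s sE] := @config_exists 3 (m.+1 + n + 1)
    (fun i => if i == i0 then m.+1 else if i == i1 then n else 1)%N.
  rewrite !big_ord_recl big_ord0 /=; lia.
pose S l := \sum_(k | (k != l) && (0 < occ s k)%N) u (occ s k) (occ s l) *
   ((right_clear s k l)%:R - (left_clear s k l)%:R).
have bal (x : 'I_3 -> R) : (forall a, 0 < x a) -> \sum_l x l * S l = 0.
  move=> x0; have /stationary_weight st3 := st 3 _ x isT (isT : 0 < m.+1 + n + 1)%N x0.
  have := inflow_sub_outflow s ex x0; rewrite st3 // subrr => /esym/eqP.
  rewrite !mulf_eq0 subr_eq0 (negbTE q1) gt_eqF ?weight_gt0 //=.
  by move/eqP.
have /(_ i1) := positive_linear_form_eq0 bal.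
have adj_right : right_clear s i0 i1.
  by apply/forallP => -[[|[|[|]]] // ?]; rewrite !cwdistE.
have adj_left : left_clear s i2 i1.
  by apply/forallP => -[[|[|[|]]] // ?]; rewrite !cwdistE.
have far_left : ~~ left_clear s i0 i1.
  by apply/forallPn; exists i2; rewrite !cwdistE sE.
have far_right : ~~ right_clear s i2 i1.
  by apply/forallPn; exists i0; rewrite !cwdistE sE.
rewrite /S big_mkcond !big_ord_recl big_ord0 /= -/i0 -/i1 -/i2 !sE /=.
rewrite adj_right adj_left (negbTE far_left) (negbTE far_right) /= => S1.
lra.
Qed.

End Balance.

Theorem theorem3p5 (R : realType) (q : R) (u : nat -> nat -> R)
    (hq0 : 0 <= q) (hq1 : q != 1) (hu : rate_function u) :
  (factorised q u <-> exists phi : nat -> R, target_only u phi) /\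
  (forall phi : nat -> R, target_only u phi ->
     one_point_function q u
       (fun (x : R) (n : nat) => x ^+ n * \prod_(1 <= i < n.+1) phi (i - 1)%N)).
Proof.
split; last by move=> phi; apply: target_only_one_point.
split=> [[f hf]|[phi hphi]].
  by exists (u 1%N); apply: one_point_target_only hf.
by eexists; apply: target_only_one_point hphi.
Qed.
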